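(* Let $G$ be a finite digraph without oriented cycles. Then the multipath complex $X(G)$ is isomorphic, as a simplicial complex, to the matching complex of $\iota(B(G))$, the underlying undirected graph of the blow-up $B(G)$ of $G$.
   Context: A quiver consists of finite sets $V$ (vertices), $E$ (edges) and maps $s,t\colon E\to V$ (source, target). A digraph is a quiver in which each edge $e$ is determined by the ordered pair $(s(e),t(e))$. A simple path is a subquiver whose edges can be ordered $e_1,\dots,e_n$ such that (i) $s(e_{i+1})=t(e_i)$ for $i<n$, (ii) $s(e_i)=s(e_j)$ or $t(e_i)=t(e_j)$ implies $i=j$, and (iii) $s(e_1)\ne t(e_n)$. An oriented cycle is a subquiver satisfying (i) and (ii) but not (iii) (in particular a self-loop is an oriented cycle). A multipath of $G$ is a spanning subquiver (same vertex set) each of whose connected components is either a single vertex or a simple path. The multipath complex $X(G)$ is the simplicial complex whose simplices are the sets of edges of multipaths of $G$ (the multipath without edges corresponding to the empty simplex). Blow-up. Let $v\in V(G)$. If $v$ has indegree and outdegree both nonzero, the blow-up $B(G,v)$ of $G$ at $v$ is the digraph obtained from $G$ by replacing $v$ with two vertices $v_{\mathrm{in}},v_{\mathrm{out}}$; edges of $G$ not incident to $v$ are kept, each edge $(w,v)$ of $G$ becomes $(w,v_{\mathrm{in}})$, each edge $(v,w)$ becomes $(v_{\mathrm{out}},w)$, and there are no other edges. If the indegree or the outdegree of $v$ is zero, $B(G,v):=G$. The blow-up $B(G)$ is obtained from $G$ by blowing up all vertices of $G$ one after the other (the result does not depend on the order). $\iota(D)$ denotes the underlying undirected graph of a digraph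 $D$, obtained by replacing each edge with an undirected edge. The matching complex of an undirected graph $H$ is the simplicial complex whose simplices are the sets of pairwise vertex-disjoint edges of $H$. *)

(* Defs.v *)
From mathcomp Require Import all_boot.

Set Implicit Arguments.
Unset Strict Implicit.
Unset Printing Implicit Defensive.

(* The empty simplex belongs to every complex.  Not every point of [ground]
   has to be a vertex. *)
Record scomplex := SComplex {
  ground : finType;
  simplices : {set {set ground}};
  simplices0 : set0 \in simplices;
  simplicesS : forall A B : {set ground}, A \subset B -> B \in simplices -> A \in simplices
}.

Definition sc_vertex (K : scomplex) : finType :=
  {x : ground K | [set x] \in simplices K}.

Definition sc_iso (K L : scomplex) : Prop :=
  exists f : sc_vertex K -> sc_vertex L, bijective f /\
    forall A : {set sc_vertex K},
      (val @: A \in simplices K) = (val @: (f @: A) \in simplices L).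

Record quiver := Quiver {
  vertex : finType;
  edge : finType;
  src : edge -> vertex;
  tgt : edge -> vertex
}.
Arguments src {q} e.
Arguments tgt {q} e.

Record digraph := Digraph {
  dquiver :> quiver;
  digraphP : injective (fun e : edge dquiver => (src e, tgt e))
}.

Record subquiver (G : quiver) := Subquiver {
  sqV : {set vertex G};
  sqE : {set edge G};
  sq_closed : forall e, e \in sqE -> (src e \in sqV) && (tgt e \in sqV)
}.

Section Multipath.
Variable G : quiver.
Implicit Types (S : subquiver G) (M N : {set edge G}) (s : seq (edge G)).

(* For [s = e_1, ..., e_n]: s(e_{i+1}) = t(e_i) for i < n, and the sources,
   as well as the targets, of the e_i are pairwise distinct. *)
Definition edge_chain s : bool :=
  [&& sorted (fun e f => tgt e == src f) s,
      uniq (map src s) & uniq (map tgt s)].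

(* n >= 1 and s(e_1) = t(e_n). *)
Definition closed_chain s : bool :=
  if s is e :: s' then src e == tgt (last e s') else false.

(* n >= 1 and s(e_1) <> t(e_n). *)
Definition open_chain s : bool :=
  if s is e :: s' then src e != tgt (last e s') else false.

(* The edges of S can be ordered so that P holds.  The vertices of S are then
   required to be exactly the endpoints of its edges: simple paths and oriented
   cycles carry no isolated vertices. *)
Definition orderable (P : pred (seq (edge G))) S : bool :=
  (sqV S == src @: sqE S :|: tgt @: sqE S)
  && has P (permutations (enum (sqE S))).

Definition simple_path S : bool :=
  orderable (fun s => edge_chain s && open_chain s) S.

Definition oriented_cycle S : bool :=
  orderable (fun s => edge_chain s && closed_chain s) S.

Definition adjacent S : rel (vertex G) := fun x y =>
  [exists e in sqE S, (src e == x) && (tgt e == y)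
                   || (src e == y) && (tgt e == x)].

Definition comp_vertices S (x : vertex G) : {set vertex G} :=
  [set y | connect (adjacent S) x y].

Definition comp_edges S (x : vertex G) : {set edge G} :=
  [set e in sqE S | src e \in comp_vertices S x].

Lemma component_closed S x e : e \in comp_edges S x ->
  (src e \in comp_vertices S x) && (tgt e \in comp_vertices S x).
Proof.
rewrite inE => /andP[eS xe]; rewrite xe /=; move: xe; rewrite !inE => xe.
apply: connect_trans xe (connect1 _); apply/existsP; exists e.
by rewrite eS !eqxx.
Qed.

Definition component S x : subquiver G := Subquiver (@component_closed S x).

Definition single_vertex S : bool := (#|sqV S| == 1) && (sqE S == set0).

Definition spanning S : bool := sqV S == setT.

Definition multipath S : bool :=
  spanning S &&
  [forall x in sqV S,
     single_vertex (component S x) || simple_path (component S x)].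

Lemma spanning_closed M e :
  e \in M -> (src e \in [set: vertex G]) && (tgt e \in [set: vertex G]).
Proof. by rewrite !inE. Qed.

Definition spanning_subquiver M : subquiver G :=
  Subquiver (@spanning_closed M).

Definition multipath_sets : {set {set edge G}} :=
  [set M | multipath (spanning_subquiver M)].

Lemma adjacent_sym S : symmetric (adjacent S).
Proof. by move=> x y; apply: eq_existsb => e; rewrite orbC. Qed.

Lemma connect_edge S e : e \in sqE S -> connect (adjacent S) (src e) (tgt e).
Proof.
by move=> eS; apply/connect1/existsP; exists e; rewrite eS !eqxx.
Qed.

Lemma chain_open_acyclic s (c : {set edge G}) :
  edge_chain s -> open_chain s -> {subset c <= s} ->
  (forall f, f \in c -> exists2 g, g \in c & tgt g = src f) -> c = set0.
Proof.
case: s => [|e s'] //; set s := e :: s' => /and3P[srt us ut] opn csub cpred.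
have src_inj i j : i < size s -> j < size s ->
    src (nth e s i) = src (nth e s j) -> i = j.
  move=> li lj eq_ij; apply/eqP; rewrite -(nth_uniq (src e) _ _ us) ?size_map //.
  by rewrite !(nth_map e) // eq_ij.
have tgt_inj i j : i < size s -> j < size s ->
    tgt (nth e s i) = tgt (nth e s j) -> i = j.
  move=> li lj eq_ij; apply/eqP; rewrite -(nth_uniq (tgt e) _ _ ut) ?size_map //.
  by rewrite !(nth_map e) // eq_ij.
have step i : i.+1 < size s -> tgt (nth e s i) = src (nth e s i.+1).
  by move=> li; apply/eqP; move/(pathP e): srt; apply.
have notin k : k < size s -> nth e s k \notin c.
  elim: k => [|k IHk] lk; apply/negP => /cpred[g gc].
    have /(nthP e)[i li <-] := csub _ gc.
    case: (ltnP i.+1 (size s)) => [li1|].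
      by rewrite step // => eq0; have := src_inj _ 0 li1 isT eq0.
    move=> lei; have -> : i = size s' by apply/eqP; rewrite eqn_leq -ltnS li.
    rewrite /s nth_last /= => eq_e; move: opn; rewrite /open_chain /s.
    by rewrite -eq_e eqxx.
  have /(nthP e)[i li eq_g] := csub _ gc; rewrite -step // -eq_g => eq_t.
  have eq_ik := tgt_inj _ _ li (ltnW lk) eq_t.
  by case/negP: (IHk (ltnW lk)); rewrite -eq_ik eq_g.
apply/setP => f; rewrite inE; apply/negP => fc.
by have /(nthP e)[i li eq_f] := csub _ fc; case/negP: (notin i li); rewrite eq_f.
Qed.

Lemma closed_chain_pred s f : edge_chain s -> closed_chain s -> f \in s ->
  exists2 g, g \in s & tgt g = src f.
Proof.
case: s => // e s' /and3P[/= srt _ _] /eqP cl.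
rewrite inE => /predU1P[->|fs']; first by exists (last e s'); rewrite ?mem_last.
case/splitPr: fs' srt cl => p1 p2; rewrite cat_path /= => /and3P[_ /eqP eq_f _] _.
exists (last e p1) => //; have := mem_last e p1.
by rewrite !inE mem_cat => /orP[->|->]; rewrite ?orbT.
Qed.

Lemma chain_connected S x s : edge_chain s -> {subset s <= sqE S} ->
  has (mem (comp_edges S x)) s -> {subset s <= comp_edges S x}.
Proof.
case: s => [|e s] // /and3P[srt _ _] sS; rewrite /= in srt.
have main f : f \in e :: s -> connect (adjacent S) (src e) (src f).
  elim: s e srt sS => [|g s IHs] e /=.
    by move=> _ _; rewrite inE => /eqP->; apply: connect0.
  case/andP=> /eqP eg srt sS; rewrite inE => /predU1P[->|fs].
    exact: connect0.
  apply: connect_trans (IHs g srt _ fs); last first.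
    by move=> h hs; apply: sS; rewrite inE hs orbT.
  by rewrite -eg; apply: connect_edge; apply: sS; rewrite mem_head.
case/hasP => g gs /=; rewrite !inE => /andP[_ xg] f fs.
rewrite !inE sS //=; apply: connect_trans xg _.
apply: connect_trans (main f fs).
by rewrite (sym_connect_sym (@adjacent_sym S)); apply: main.
Qed.

Lemma multipathP M :
  reflect [/\ {in M &, injective src}, {in M &, injective tgt}
            & forall s, {subset s <= M} -> edge_chain s -> ~~ closed_chain s]
          (multipath (spanning_subquiver M)).
Proof.
set S := spanning_subquiver M.
have csym := sym_connect_sym (@adjacent_sym S).
apply: (iffP andP) => [[_ /forall_inP mpM]|[srcI tgtI noC]].
  have compP e : e \in M -> exists s, [/\ edge_chain s, open_chain s,
      s =i comp_edges S (src e) & perm_eq s (enum (comp_edges S (src e)))].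
    move=> eM; have eC : e \in comp_edges S (src e).
      by rewrite !inE eM connect0.
    case/orP: (mpM (src e) (in_setT _)) => [/andP[_ /eqP /= C0]|].
      by rewrite C0 inE in eC.
    case/andP => _ /hasP[s]; rewrite mem_permutations => ps /andP[cs os].
    by exists s; split=> // f; rewrite (perm_mem ps) mem_enum.
  split=> [e f eM fM ef|e f eM fM ef|s sM cs].
  - have [s [/and3P[_ us _] _ _ ps]] := compP e eM.
    rewrite (perm_uniq (perm_map src ps)) in us.
    have {us} /dinjectiveP uC : dinjectiveb src (comp_edges S (src e)) by [].
    by apply: uC => //; rewrite !inE ?eM ?fM ?ef connect0.
  - have [s [/and3P[_ _ ut] _ _ ps]] := compP e eM.
    rewrite (perm_uniq (perm_map tgt ps)) in ut.
    have {ut} /dinjectiveP uC : dinjectiveb tgt (comp_edges S (src e)) by [].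
    apply: uC => //; rewrite !inE ?eM ?fM ?connect0 //=.
    apply: connect_trans (connect_edge (S := S) eM) _.
    by rewrite ef csym; apply: connect_edge.
  apply/negP => cl; case: s sM cs cl => // e s' sM cs cl.
  have eM : e \in M by apply: sM; rewrite mem_head.
  have [s [cs0 os eqs _]] := compP e eM.
  have /setP/(_ e) : [set f in e :: s'] = set0.
    apply: (chain_open_acyclic cs0 os) => [f|f]; rewrite inE => fs.
      rewrite eqs; apply: (@chain_connected S _ _ cs sM) fs => //=.
      by rewrite !inE eM connect0.
    have [g gs eq_g] := closed_chain_pred cs cl fs.
    by exists g; rewrite ?inE.
  by rewrite !inE eqxx.
split; first exact: eqxx.
apply/forall_inP => x _; case: (set_0Vmem (comp_edges S x)) => [C0|[e0 e0C]].
  apply/orP; left; rewrite /single_vertex /= C0 eqxx andbT.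
  have -> : comp_vertices S x = [set x]; last by rewrite cards1.
  apply/setP=> y; rewrite !inE; apply/idP/eqP => [|->]; last exact: connect0.
  case/connectP => [[|z p]] //= /andP[/existsP[e /andP[eM xz]] _] _.
  have : e \in set0; last by rewrite inE.
  rewrite -C0 !inE eM /=; case/orP: xz => /andP[/eqP ez /eqP tz].
    by rewrite ez; apply: connect0.
  by rewrite csym -tz; apply: connect_edge.
apply/orP; right.
have e0M : e0 \in M by move: e0C; rewrite inE => /andP[].
pose Q n := [exists t : n.-tuple (edge G),
   [&& all (mem M) t, edge_chain t, open_chain t & e0 \in tval t]].
have exQ : exists n, Q n.
  exists 1; apply/existsP; exists [tuple e0].
  rewrite /= e0M mem_head /edge_chain /= andbT.
  have /= := noC [:: e0]; rewrite /edge_chain /=; apply=> // f.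
  by rewrite inE => /eqP->.
have bQ n : Q n -> n <= #|edge G|.
  case/existsP => t /and4P[_ /and3P[_ /map_uniq ut _] _ _].
  by rewrite -(size_tuple t) -(card_uniqP ut) max_card.
case: (ex_maxnP exQ bQ) => n /existsP[t /and4P[/allP tM ct ot e0t]] maxn.
have {maxn bQ exQ} maxt s : {subset s <= M} -> edge_chain s -> open_chain s ->
    e0 \in s -> size s <= size t.
  move=> sM cs os e0s; rewrite size_tuple; apply: maxn; apply/existsP.
  by exists (in_tuple s); rewrite cs os e0s !andbT; apply/allP.
move: (tval t) tM ct ot e0t maxt => {t}[|e s'] //.
set s := e :: s' => sM cs os e0s maxs.
have [srt us ut] := and3P cs.
have step i : i.+1 < size s -> tgt (nth e s i) = src (nth e s i.+1).
  by move=> li; apply/eqP; move/(pathP e): srt; apply.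
have nthM i : i < size s -> nth e s i \in M by move=> li; apply/sM/mem_nth.
pose W := src @: [set f in s] :|: tgt @: [set f in s].
have openM r : {subset r <= M} -> edge_chain r -> r != [::] -> open_chain r.
  by move=> rM cr; have := noC r rM cr; case: r rM cr.
have Wcl f : f \in M -> (src f \in W) || (tgt f \in W) -> f \in s.
  move=> fM fW; apply: contraT => fs.
  have fsrc : src f \notin map src s.
    apply/mapP => -[g gs fg]; case/negP: fs.
    by rewrite (srcI f g) //; apply: sM.
  have ftgt : tgt f \notin map tgt s.
    apply/mapP => -[g gs fg]; case/negP: fs.
    by rewrite (tgtI f g) //; apply: sM.
  case/orP: fW; rewrite inE => /orP[] /imsetP[g]; rewrite inE => gs fg.
  - by case/negP: fsrc; rewrite fg map_f.
  - case/(nthP e): gs => i li ig; rewrite -ig in fg.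
    case: (ltnP i.+1 (size s)) => [li1|lei].
      by case/negP: fsrc; rewrite fg step // map_f // mem_nth.
    have iE : i = size s' by apply/eqP; rewrite eqn_leq -ltnS li.
    have rM : {subset rcons s f <= M}.
      by move=> h; rewrite mem_rcons inE => /predU1P[->|/sM].
    have cr : edge_chain (rcons s f).
      rewrite /edge_chain !map_rcons !rcons_uniq fsrc ftgt us ut !andbT.
      by rewrite /= rcons_path; apply/andP; split=> //; rewrite fg iE nth_last.
    have := maxs _ rM cr (openM _ rM cr isT).
    by rewrite mem_rcons inE e0s orbT size_rcons ltnn => /(_ isT).
  - case/(nthP e): gs => i li ig; rewrite -ig in fg.
    case: i li ig fg => [|i] li ig fg; last first.
      by case/negP: ftgt; rewrite fg -step // map_f // mem_nth // ltnW.
    have rM : {subset f :: s <= M}.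
      by move=> h; rewrite inE => /predU1P[->|/sM].
    have cr : edge_chain (f :: s).
      rewrite /edge_chain (map_cons src) (map_cons tgt) !(cons_uniq _ (map _ s)).
      by rewrite fsrc ftgt us ut !andbT /= fg eqxx.
    have := maxs _ rM cr (openM _ rM cr isT).
    by rewrite inE e0s orbT /= ltnn => /(_ isT).
  - by case/negP: ftgt; rewrite fg map_f.
have WS f : f \in s -> (src f \in W) && (tgt f \in W).
  by move=> fs; apply/andP; split; rewrite inE imset_f ?orbT ?inE.
have connW y z : y \in W -> connect (adjacent S) y z -> z \in W.
  move=> yW /connectP[p pp ->{z}]; elim: p y yW pp => [|z p IHp] y yW //=.
  case/andP => /existsP[f /andP[fM yz]]; apply: IHp.
  have fs : f \in s.
    by apply: Wcl => //; case/orP: yz => /andP[/eqP yf /eqP zf];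
       rewrite ?yf ?zf yW ?orbT.
  have /andP[] := WS _ fs.
  by case/orP: yz => /andP[/eqP-> /eqP->].
have sC : s =i comp_edges S x.
  move=> f; apply/idP/idP => [|fC].
    apply: (@chain_connected S _ _ cs sM); apply/hasP; by exists e0.
  have fM : f \in M by move: fC; rewrite inE => /andP[].
  apply: Wcl => //; apply/orP; left; apply: (connW (src e0)).
    by have /andP[] := WS _ e0s.
  move: e0C fC; rewrite !inE => /andP[_ xe0] /andP[_ xf].
  by apply: connect_trans xf; rewrite csym.
have sE : [set f in s] = comp_edges S x by apply/setP => f; rewrite inE sC.
apply/andP; split; last first.
  apply/hasP; exists s; last by rewrite cs os.
  rewrite mem_permutations; apply: uniq_perm; rewrite ?enum_uniq //.
    exact: map_uniq us.
  by move=> f; rewrite mem_enum sC.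
rewrite /= -sE; apply/eqP/setP => y; rewrite -/W; apply/idP/idP => [yC|].
  apply: (connW (src e0)); first by have /andP[] := WS _ e0s.
  move: e0C yC; rewrite !inE => /andP[_ xe0]; apply: connect_trans.
  by rewrite csym.
rewrite /W sE inE => /orP[] /imsetP[f fC ->].
  by have /andP[] := component_closed fC.
by have /andP[] := component_closed fC.
Qed.

Lemma multipath_sets0 : set0 \in multipath_sets.
Proof.
rewrite inE; apply/multipathP; split=> [e|e|[|e s] sM] //; rewrite ?inE //.
by have := sM e (mem_head _ _); rewrite inE.
Qed.

Lemma multipath_setsS M N :
  M \subset N -> N \in multipath_sets -> M \in multipath_sets.
Proof.
move=> /subsetP MN; rewrite !inE => /multipathP[srcI tgtI noC].
apply/multipathP; split=> [e f /MN eN /MN fN|e f /MN eN /MN fN|s sM].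
- exact: srcI.
- exact: tgtI.
- by apply: noC => f /sM/MN.
Qed.

Definition multipath_complex : scomplex :=
  SComplex multipath_sets0 multipath_setsS.

End Multipath.

Definition acyclic (G : quiver) : Prop :=
  forall S : subquiver G, ~~ oriented_cycle S.

Section BlowUp.
Variable G : digraph.
Implicit Type v : vertex G.

Definition indeg v := #|[set e : edge G | tgt e == v]|.
Definition outdeg v := #|[set e : edge G | src e == v]|.

(* The replacement of v by v_in and v_out: in [option (vertex G)], [Some v]
   is v_in, [None] is v_out, and [Some w] is the vertex w for w != v.  The
   edges keep their names and only their endpoints change. *)
Definition split_quiver v : quiver :=
  @Quiver (option (vertex G)) (edge G)
    (fun e => if src e == v then None else Some (src e))
    (fun e => Some (tgt e)).

Lemma split_quiver_inj v :
  injective (fun e : edge (split_quiver v) => (src e, tgt e)).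
Proof.
move=> e f [/= es et]; apply: (@digraphP G); congr pair => //; move: es.
by do 2![case: eqP => [->|_]] => // -[].
Qed.

Definition split_digraph v : digraph := Digraph (@split_quiver_inj v).

Definition splits v : bool := (0 < indeg v) && (0 < outdeg v).

Definition blowup_at v : digraph := if splits v then split_digraph v else G.

(* Meaningful only on the vertices w != v, which remain vertices of B(G, v). *)
Definition blowup_keep v : vertex G -> vertex (blowup_at v) :=
  if splits v as b
    return vertex G -> vertex (if b then split_digraph v else G)
  then Some else id.

End BlowUp.

Fixpoint blowup_rec (T : Type) (s : seq T) (G : digraph) (f : T -> vertex G)
    : digraph :=
  if s is v :: s' then
    blowup_rec s' (fun w => blowup_keep (f v) (f w))
  else G.

(* For [s] an enumeration of the vertices of G, this is the blow-up B(G),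
   computed by blowing up the vertices of G in the order [s]. *)
Definition blowup (G : digraph) (s : seq (vertex G)) : digraph :=
  blowup_rec s id.
Arguments blowup : clear implicits.

(* Undirected graphs without multiple edges; loops are singletons. *)
Record ugraph := UGraph {
  uvertex : finType;
  uedges : {set {set uvertex}};
  uedgesP : forall e, e \in uedges -> 0 < #|e| <= 2
}.

Section Underlying.
Variable D : digraph.

Definition underlying_edges : {set {set vertex D}} :=
  [set [set src e; tgt e] | e : edge D].

Lemma underlying_edgesP e : e \in underlying_edges -> 0 < #|e| <= 2.
Proof. by case/imsetP => f _ ->; rewrite cards2; case: (_ != _). Qed.

Definition underlying : ugraph := UGraph underlying_edgesP.

End Underlying.

Section Matching.
Variable H : ugraph.

Definition matchings : {set {set {set uvertex H}}} :=
  [set M : {set {set uvertex H}} | (M \subset uedges H) && trivIset M].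

Lemma matchings0 : set0 \in matchings.
Proof. by rewrite inE sub0set; apply/trivIsetP => A; rewrite inE. Qed.

Lemma matchingsS (M N : {set {set uvertex H}}) : M \subset N -> N \in matchings -> M \in matchings.
Proof.
move=> MN; rewrite !inE => /andP[NH tN].
by rewrite (subset_trans MN NH) (trivIsetS MN tN).
Qed.

Definition matching_complex : scomplex := SComplex matchings0 matchingsS.

End Matching.

(* Main.v *)
Require Import Defs.
From mathcomp Require Import all_boot.

(** In an acyclic digraph a set of edges is a multipath iff its elements have
    pairwise distinct sources and pairwise distinct targets.  Blowing up keeps
    the edges, preserves coincidences among sources and among targets, and
    destroys every coincidence between a source and a target.  So in the blow-up
    two edges are disjoint exactly when their sources and their targets differ,
    and sending an edge to its underlying pair of endpoints is the isomorphism. *)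

Set Implicit Arguments.
Unset Strict Implicit.
Unset Printing Implicit Defensive.

(** Isomorphisms live on vertices, while [g] is defined on ground sets and need not be onto: in a
    matching complex only the edges of the graph are vertices. It is enough that [g] reaches the
    singleton simplices. *)
Lemma sc_iso_of_injection (K L : scomplex) (g : ground K -> ground L) :
  injective g ->
  (forall A : {set ground K}, (A \in simplices K) = (g @: A \in simplices L)) ->
  (forall y, [set y] \in simplices L -> exists x, g x = y) ->
  sc_iso K L.
Proof.
move=> g_inj gK g_surj.
have gP (x : sc_vertex K) : [set g (val x)] \in simplices L.
  by rewrite -imset_set1 -gK (valP x).
pose f (x : sc_vertex K) : sc_vertex L := Sub (g (val x)) (gP x).
exists f; split=> [|A]; last first.
  rewrite gK -!imset_comp; congr (_ \in _); exact: eq_imset.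
have f_inj : injective f by move=> x y /(congr1 val) /= /g_inj /val_inj.
apply: inj_card_bij => //; apply: leq_trans (leq_image_card f predT).
apply: subset_leq_card; apply/subsetP => y _.
have [x gx] := g_surj _ (valP y).
have xP : [set x] \in simplices K by rewrite gK imset_set1 gx (valP y).
have -> : y = f (Sub x xP) by apply: val_inj; rewrite /= -gx.
exact: image_f.
Qed.

(** The edges of a closed chain, with exactly their endpoints as vertices, would form an oriented
    cycle. *)
Lemma acyclic_chain (G : quiver) (s : seq (edge G)) :
  acyclic G -> edge_chain s -> ~~ closed_chain s.
Proof.
move=> acG cs; apply/negP => cl.
pose E := [set e in s].
have closedE e : e \in E ->
    (src e \in src @: E :|: tgt @: E) && (tgt e \in src @: E :|: tgt @: E).
  by move=> eE; rewrite !inE !imset_f ?orbT.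
case/negP: (acG (Subquiver closedE)); rewrite /oriented_cycle /orderable eqxx /=.
apply/hasP; exists s; last by rewrite cs.
have [_ us _] := and3P cs.
rewrite mem_permutations; apply: uniq_perm; rewrite ?enum_uniq ?(map_uniq us) //.
by move=> e; rewrite mem_enum inE.
Qed.

Lemma acyclic_multipathP (G : quiver) (M : {set edge G}) :
  acyclic G ->
  reflect ({in M &, injective src} /\ {in M &, injective tgt})
          (M \in multipath_sets G).
Proof.
move=> acG; rewrite inE; apply: (iffP (multipathP M)) => [[] //|[srcI tgtI]].
by split=> // s _; apply: acyclic_chain.
Qed.

(** Edges keep their names, so [phi] is the identity in both cases; it is hidden behind an
    existential because the type of [blowup_at v] depends on [splits v]. The last clause lets an
    induction follow the vertices still to be blown up. *)
Lemma blowup_at_edges (G : digraph) (v : vertex G) :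
  exists2 phi : edge G -> edge (blowup_at v), bijective phi &
  [/\ forall e f, (src (phi e) == src (phi f)) = (src e == src f),
      forall e f, (tgt (phi e) == tgt (phi f)) = (tgt e == tgt f),
      forall e f, (src (phi e) == tgt (phi f))
                  = (src e == tgt f) && (src e != v)
    & forall e w, src e != v ->
        (src (phi e) == blowup_keep v w) = (src e == w)].
Proof.
rewrite /blowup_at /blowup_keep; case E: (splits v).
  exists id; first by exists id.
  split=> [e f|e f|e f|e w ev] //=; last by rewrite (negPf ev).
    case: (altP (src e =P v)) => [->|ev];
      case: (altP (src f =P v)) => [->|fv] //.
        by rewrite !eqxx.
      by rewrite [RHS]eq_sym (negPf fv).
    by rewrite (negPf ev).
  by case: (src e =P v); rewrite ?andbT ?andbF.
exists id; first by exists id.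
split=> // e f; case: (src e =P v) => /= [ev|_]; last by rewrite andbT.
(* Here [v] is not split: an edge [e] leaving [v] and an edge [f] entering it would make both
   degrees positive. *)
rewrite andbF; apply/negP => /eqP ef; move/negP: E; apply; rewrite /splits.
apply/andP; split; apply/card_gt0P; [exists f | exists e]; rewrite inE ?ev //.
by rewrite -ef ev.
Qed.

(** Induction on [s] with [G] and [h] general, since each step changes the digraph and the naming of
    the remaining vertices. *)
Lemma blowup_rec_edges (T : Type) (s : seq T) (G : digraph) (h : T -> vertex G) :
  exists2 phi : edge G -> edge (blowup_rec s h), bijective phi &
  [/\ forall e f, (src (phi e) == src (phi f)) = (src e == src f),
      forall e f, (tgt (phi e) == tgt (phi f)) = (tgt e == tgt f)
    & forall e f, (src (phi e) == tgt (phi f))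
                  = (src e == tgt f) && (src e \notin map h s)].
Proof.
elim: s G h => [|v s IHs] G h /=.
  by exists id; [exists id | split=> // e f; rewrite andbT].
have [phi phi_bij [phi_s phi_t phi_st phi_k]] := blowup_at_edges (h v).
have [psi psi_bij [psi_s psi_t psi_st]] :=
  IHs _ (fun w => blowup_keep (h v) (h w)).
exists (psi \o phi); first exact: bij_comp.
split=> e f /=; rewrite ?psi_s ?psi_t ?phi_s ?phi_t //.
rewrite psi_st phi_st inE negb_or -!andbA.
case: (boolP (src e == h v)) => //= ev; congr (_ && ~~ _).
(* The remaining vertices are named in the blow-up at [h v]; as [src e] is not [h v], [phi_k]
   carries the membership test back to [G]. *)
elim: s {IHs psi psi_bij psi_s psi_t psi_st} => //= w s IHs.
by rewrite !inE phi_k // IHs.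
Qed.

Lemma blowup_edges (G : digraph) (s : seq (vertex G)) :
  perm_eq s (enum (vertex G)) ->
  exists2 phi : edge G -> edge (blowup G s), bijective phi &
  [/\ forall e f, (src (phi e) == src (phi f)) = (src e == src f),
      forall e f, (tgt (phi e) == tgt (phi f)) = (tgt e == tgt f)
    & forall e f, src (phi e) != tgt (phi f)].
Proof.
move=> ps; have [phi phi_bij [phi_s phi_t phi_st]] := blowup_rec_edges s id.
exists phi => //; split=> // e f.
by rewrite phi_st map_id (perm_mem ps) mem_enum andbF.
Qed.

Theorem theorem4p20 (G : digraph) (s : seq (vertex G)) :
  acyclic G ->
  perm_eq s (enum (vertex G)) ->
  sc_iso (multipath_complex G) (matching_complex (underlying (blowup G s))).
Proof.
move=> acG ps; have [phi phi_bij [phi_s phi_t phi_st]] := blowup_edges ps.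
pose g (e : edge G) : {set vertex (blowup G s)} :=
  [set src (phi e); tgt (phi e)].
have g_disj e f : [disjoint g e & g f] = (src e != src f) && (tgt e != tgt f).
  rewrite -phi_s -phi_t -setI_eq0; apply/eqP/andP => [/setP dis|[es et]].
    split; apply/eqP => eq_ef.
      by have := dis (src (phi e)); rewrite !inE eq_ef eqxx.
    by have := dis (tgt (phi e)); rewrite !inE eq_ef eqxx !orbT.
  (* A common endpoint cannot be a source of one edge and a target of the other, by [phi_st]. *)
  apply/setP => x; rewrite !inE; apply/negP => /andP[/orP[]/eqP->].
    by rewrite (negPf es) (negPf (phi_st _ _)).
  by rewrite (negPf et) eq_sym (negPf (phi_st _ _)).
have g_inj : injective g.
  (* No source is a target in the blow-up, so the unordered pair [g e] determines its orientation,
     hence both endpoints of [e] in [G]. *)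
  move=> e f ef; have : src (phi e) \in g f by rewrite -ef !inE eqxx.
  rewrite !inE (negPf (phi_st _ _)) orbF phi_s => /eqP es.
  have : tgt (phi e) \in g f by rewrite -ef !inE eqxx orbT.
  rewrite !inE eq_sym (negPf (phi_st _ _)) phi_t => /eqP et.
  by apply: (@digraphP G); rewrite es et.
have gE A : A \in uedges (underlying (blowup G s)) -> exists e, g e = A.
  case/imsetP => e _ ->; have [psi _ psiK] := phi_bij.
  by exists (psi e); rewrite /g psiK.
pose L := matching_complex (underlying (blowup G s)).
apply: (@sc_iso_of_injection (multipath_complex G) L g) => //= [M|A]; last first.
  by rewrite inE sub1set => /andP[/gE].
apply/(acyclic_multipathP M acG)/idP => [[srcI tgtI]|].
  rewrite inE; apply/andP; split.
    by apply/subsetP => _ /imsetP[e _ ->]; apply: imset_f.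
  apply/trivIsetP => _ _ /imsetP[e eM ->] /imsetP[f fM ->] ef.
  have {ef} nef : e != f by apply: contraNneq ef => ->.
  rewrite g_disj; apply/andP.
  by split; apply: contraNneq nef => eq_ef; apply/eqP; [apply: srcI | apply: tgtI].
rewrite inE => /andP[_ /trivIsetP trivM].
(* [trivIset] only separates distinct sets; injectivity of [g] makes this apply to distinct
   edges. *)
have disM e f : e \in M -> f \in M -> e != f ->
    (src e != src f) && (tgt e != tgt f).
  by move=> eM fM ef; rewrite -g_disj trivM ?imset_f // inj_eq.
by split=> e f eM fM ef; apply/eqP/contraT => /(disM _ _ eM fM);
  rewrite ef eqxx ?andbF.
Qed.
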